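(* Let $G$ be a finite simple connected graph with vertex set $V$, adjacency matrix $A$ and diagonal degree matrix $D$. Let $\mathbf 1\in\mathbb R^V$ be the all-ones vector and $J=\mathbf 1\mathbf 1^T$. Let $\mathcal A(G)=\langle I,A,D\rangle\subseteq M_V(\mathbb R)$ and $M_G=\mathcal A(G)\mathbf 1$. Then $$\mathcal A(G)\,J\,\mathcal A(G)=\operatorname{span}\{uv^T : u,v\in M_G\}.$$ Moreover, after restriction to $M_G$, this ideal is the full endomorphism algebra $\operatorname{End}(M_G)$; that is, the restrictions $X|_{M_G}$, $X\in\mathcal A(G)J\mathcal A(G)$, are exactly all $\mathbb R$-linear endomorphisms of $M_G$.
   Context: $M_V(\mathbb R)$ is the algebra of real matrices indexed by $V\times V$. $\langle I,A,D\rangle$ denotes the real (unital, associative) subalgebra generated by $I,A,D$. $M_G=\{X\mathbf 1: X\in\mathcal A(G)\}$ is the cyclic module generated by $\mathbf 1$. $\mathcal A(G)J\mathcal A(G)$ denotes the real linear span of all products $XJY$ with $X,Y\in\mathcal A(G)$. *)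

(* Defs.v *)
From HB Require Import structures.
From mathcomp Require Import all_boot all_order all_algebra.
From mathcomp Require Import boolp classical_sets reals.

Set Implicit Arguments.
Unset Strict Implicit.
Unset Printing Implicit Defensive.

Import Order.TTheory GRing.Theory Num.Theory.

Local Open Scope classical_set_scope.
Local Open Scope ring_scope.

Definition connected_graph (V : finType) (e : rel V) : Prop :=
  forall x y : V, connect e x y.

Definition lin_span (R : pzRingType) (W : lmodType R) (S : set W) : set W :=
  smallest [set B : set W | GRing.submod_closed (mem B)] S.

(* This is [GRing.subalg_closed], whose carrier must be a nontrivial ring and
   so cannot be 'M[R]_n for a variable n. *)
Definition mx_subalg_closed (R : pzRingType) n (C : {pred 'M[R]_n}) : Prop :=
  [/\ 1%:M \in C, GRing.linear_closed C & GRing.mulr_2closed C].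

Definition generated_subalg (R : pzRingType) n (S : set 'M[R]_n) :
  set 'M[R]_n := smallest [set C : set 'M[R]_n | mx_subalg_closed (mem C)] S.

Definition two_sided_ideal (R : pzRingType) n (C I : set 'M[R]_n) :
    Prop :=
  [/\ I `<=` C, GRing.submod_closed (mem I) &
      forall X Y, C X -> I Y -> I (X *m Y) /\ I (Y *m X)].

(* MathComp matrices are indexed by ordinals: a V x V matrix is indexed by
   'I_#|V|, the index i standing for the vertex [enum_val i]. *)
Section GraphAlgebra.
Context (R : realType) (V : finType) (e : rel V).

Definition adjacency_mx : 'M[R]_#|V| :=
  \matrix_(i, j) (e (enum_val i) (enum_val j))%:R.

Definition degree_mx : 'M[R]_#|V| :=
  diag_mx (\row_i #|[set y | e (enum_val i) y]%SET|%:R).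

Definition ones : 'cV[R]_#|V| := const_mx 1.

Definition allones_mx : 'M[R]_#|V| := ones *m ones^T.

Definition graph_alg : set 'M[R]_#|V| :=
  generated_subalg [set 1%:M; adjacency_mx; degree_mx].

Definition graph_ideal : set 'M[R]_#|V| :=
  lin_span [set X *m allones_mx *m Y | X in graph_alg & Y in graph_alg].

Definition graph_mod : set 'cV[R]_#|V| := [set X *m ones | X in graph_alg].

Definition graph_mod_pred : {pred 'cV[R]_#|V|} := mem graph_mod.

Lemma graph_mod_submod_closed : GRing.submod_closed graph_mod_pred.
Proof.
split=> [|a u v].
  apply/mem_set; exists 0; last by rewrite mul0mx.
  by move=> B [[B1 Blin _] _]; have := Blin (-1) _ _ B1 B1;
    rewrite scaleN1r addNr => /set_mem.
move=> /set_mem[X AX <-] /set_mem[Y AY <-]; apply/mem_set.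
exists (a *: X + Y); last by rewrite mulmxDl -scalemxAl.
move=> B HB; have [[_ Blin _] _] := HB.
by apply: set_mem; apply: Blin; apply: mem_set; [exact: AX|exact: AY].
Qed.

HB.instance Definition _ :=
  GRing.isSubmodClosed.Build R 'cV[R]_#|V| graph_mod_pred
    graph_mod_submod_closed.

(* M_G as an R-module in its own right. *)
Definition graph_modType := {u : 'cV[R]_#|V| | u \in graph_mod_pred}.

HB.instance Definition _ := SubChoice.on graph_modType.
HB.instance Definition _ := [SubChoice_isSubLmodule of graph_modType by <:].

Definition restricts_to (X : 'M[R]_#|V|) (f : graph_modType -> graph_modType) :
  Prop := forall u : graph_modType, val (f u) = X *m val u.

End GraphAlgebra.

Arguments graph_alg R {V} e.
Arguments graph_ideal R {V} e.
Arguments graph_mod R {V} e.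
Arguments graph_modType R {V} e.

(* Main.v *)
Require Import Defs.
From mathcomp Require Import all_boot all_order all_algebra.
From mathcomp Require Import boolp classical_sets reals.

(** Everything rests on J lying in A(G).  The Laplacian L = D - A is a real
    symmetric matrix in A(G), and on a connected graph its kernel is the line
    spanned by the all-ones vector (maximum principle).  Write the
    characteristic polynomial of L as 'X^k * r with r(0) != 0.
    By Cayley-Hamilton r(L) L^k = 0, and since a real symmetric matrix acts
    semisimply, already r(L) L = L r(L) = 0: the rows and the columns of r(L)
    lie in the kernel of L, so r(L) is a scalar multiple of J.  The scalar is
    nonzero because r(L) maps the all-ones vector to r(0) times itself.  Hence
    J is a polynomial in L (subalg_const_mx, graph_alg_allones).

    The algebra A(G) is closed under transposition, its generators being
    symmetric, so X J Y = (X 1) (Y^T 1)^T identifies the products X J Y with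
    the rank-one matrices u v^T, for u, v in M_G; this gives the equality of
    spans (graph_ideal_gens), and J in A(G) makes the span an ideal of A(G).
    For the endomorphisms, the standard inner product is positive
    definite on M_G, so M_G has a basis b_i with a dual basis c_i that again
    lies in M_G; an endomorphism f is then the restriction of the matrix
    sum_i f(b_i) c_i^T (submod_dual_basis, submod_endo_mx). *)

Set Implicit Arguments.
Unset Strict Implicit.
Unset Printing Implicit Defensive.

Import Order.TTheory GRing.Theory Num.Theory.

Local Open Scope classical_set_scope.
Local Open Scope ring_scope.

(** * Real matrices and the transpose *)

Lemma mulmx_tr_eq0 {R : realFieldType} m n (N : 'M[R]_(m, n)) :
  N *m N^T = 0 -> N = 0.
Proof.
move=> N0; apply/matrixP => i j; rewrite mxE.
have /eqP : (N *m N^T) i i = 0 by rewrite N0 mxE.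
rewrite mxE psumr_eq0; last by move=> k _; rewrite mxE -expr2 sqr_ge0.
by move=> /allP/(_ j (mem_index_enum _)); rewrite mxE mulf_eq0 orbb => /eqP.
Qed.

Lemma gram_unitmx {R : realFieldType} m n (B : 'M[R]_(m, n)) :
  row_free B -> B *m B^T \in unitmx.
Proof.
move=> Bfree; rewrite -row_free_unit -kermx_eq0.
set K := kermx _; have K0 : K *m (B *m B^T) = 0 by rewrite mulmx_ker.
have KB0 : K *m B = 0.
  by apply: mulmx_tr_eq0; rewrite trmx_mul mulmxA -(mulmxA K) K0 mul0mx.
by apply/eqP; apply: (row_free_inj Bfree); rewrite KB0 mul0mx.
Qed.

(** Semisimplicity of a symmetric matrix, in the form needed here: M L L = 0
    makes (M L) (M L)^T vanish, so powers of L can be cancelled down to L. *)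
Lemma symmetric_mul_exp_eq0 {R : realFieldType} n (L M : 'M[R]_n.+1) k :
  L^T = L -> M * L ^+ k = 0 -> M * L = 0.
Proof.
move=> Lsym; elim: k => [|k IHk].
  by rewrite expr0 mulr1 => ->; rewrite mul0r.
case: k IHk => [_|k IHk ML0]; first by rewrite expr1.
apply: IHk; apply: mulmx_tr_eq0.
rewrite [in _^T]exprSr mulrA -[(_ * L)^T]/((_ *m L)^T) trmx_mul Lsym mulmxA.
by rewrite !mulmxE -(mulrA M) -exprSr ML0 mul0r.
Qed.

Lemma horner_mx_ker {R : comNzRingType} n (L : 'M[R]_n.+1) (x : 'cV_n.+1) p :
  L *m x = 0 -> horner_mx L p *m x = p.[0] *: x.
Proof.
move=> Lx0; elim/poly_ind: p => [|p c _].
  by rewrite rmorph0 mul0mx horner0 scale0r.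
rewrite rmorphD rmorphM /= horner_mx_X horner_mx_C mulmxDl -mulmxE -mulmxA Lx0.
by rewrite mulmx0 add0r mul_scalar_mx !hornerE.
Qed.

(** * Closure properties of spans and generated algebras *)

Section LinSpan.
Context {R : pzRingType} {W : lmodType R}.
Implicit Types (S B : set W).

Lemma submod_closedP B :
  GRing.submod_closed (mem B) <->
  B 0 /\ forall a u v, B u -> B v -> B (a *: u + v).
Proof.
split=> -[B0 Blin]; split; [exact: set_mem| |exact: mem_set|].
  by move=> a u v Bu Bv; apply/set_mem/Blin; apply/mem_set.
by move=> a u v /set_mem Bu /set_mem Bv; apply/mem_set/Blin.
Qed.

Lemma lin_span_closed S : GRing.submod_closed (mem (lin_span S)).
Proof.
apply/submod_closedP; split=> [|a u v Su Sv] B BS.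
  by have [/submod_closedP[]] := BS.
have [/submod_closedP[_ Blin] _] := BS.
by apply: Blin; [exact: Su|exact: Sv].
Qed.

Lemma mem_lin_span S u : S u -> lin_span S u.
Proof. exact: sub_gen_smallest. Qed.

Lemma lin_span_sub S B :
  GRing.submod_closed (mem B) -> S `<=` B -> lin_span S `<=` B.
Proof. by move=> Bcl SB; apply: smallest_sub. Qed.

Lemma submod_closed_sum B (I : finType) (F : I -> W) :
  GRing.submod_closed (mem B) -> (forall i, B (F i)) -> B (\sum_i F i).
Proof.
move=> /submod_closedP[B0 Blin] BF; elim/big_ind: _ => // u v Bu Bv.
by rewrite -[u]scale1r; apply: Blin.
Qed.

End LinSpan.

Section MxSubalg.
Context {R : pzRingType} {n : nat}.
Implicit Types (S C : set 'M[R]_n).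

Lemma mx_subalg_closedP C :
  mx_subalg_closed (mem C) <->
  [/\ C 1%:M, forall a X Y, C X -> C Y -> C (a *: X + Y)
    & forall X Y, C X -> C Y -> C (X *m Y)].
Proof.
split=> -[C1 Clin CM]; split; [exact: set_mem| | |exact: mem_set| |].
- by move=> a X Y CX CY; apply/set_mem/Clin; apply/mem_set.
- by move=> X Y CX CY; apply/set_mem/CM; apply/mem_set.
- by move=> a X Y /set_mem CX /set_mem CY; apply/mem_set/Clin.
- by move=> X Y /set_mem CX /set_mem CY; apply/mem_set/CM.
Qed.

Lemma generated_subalg_closed S : mx_subalg_closed (mem (generated_subalg S)).
Proof.
apply/mx_subalg_closedP; split=> [|a X Y SX SY|X Y SX SY] C CS;
  have [/mx_subalg_closedP[C1 Clin CM] _] := CS => //.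
  by apply: Clin; [exact: SX|exact: SY].
by apply: CM; [exact: SX|exact: SY].
Qed.

Lemma mx_subalg_submod C :
  mx_subalg_closed (mem C) -> GRing.submod_closed (mem C).
Proof.
move=> /mx_subalg_closedP[C1 Clin _]; apply/submod_closedP; split=> //.
by have := Clin (-1) _ _ C1 C1; rewrite scaleN1r addNr.
Qed.

End MxSubalg.

Lemma generated_subalg_tr {R : comPzRingType} n (S : set 'M[R]_n) X :
  (forall Y, S Y -> S Y^T) -> generated_subalg S X -> generated_subalg S X^T.
Proof.
have /mx_subalg_closedP[S1 Slin SM] := generated_subalg_closed S.
move=> Str; move: X.
apply: (@smallest_sub _ _ _ [set X | generated_subalg S X^T]) => [|Y SY].
  apply/mx_subalg_closedP; split=> [|a Y Z SY SZ|Y Z SY SZ] /=.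
  - by rewrite trmx1.
  - by rewrite linearP; apply: Slin.
  - by rewrite trmx_mul; apply: SM.
by apply: sub_gen_smallest; apply: Str.
Qed.

Lemma subalg_horner_mx {R : comNzRingType} n (C : set 'M[R]_n.+1) L p :
  mx_subalg_closed (mem C) -> C L -> C (horner_mx L p).
Proof.
move=> CC CL; have /submod_closedP[C0 _] := mx_subalg_submod CC.
have /mx_subalg_closedP[C1 Clin CM] := CC.
elim/poly_ind: p => [|p c IHp]; first by rewrite rmorph0.
rewrite rmorphD rmorphM /= horner_mx_X horner_mx_C addrC -scalemx1.
by apply: Clin => //; apply: CM.
Qed.

(** The polynomial is the characteristic polynomial of L stripped of its
    factors 'X: its value N at L is killed by L on both sides, hence has
    constant rows and columns, while it acts on the all-ones vector by a nonzero
    scalar. *)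
Lemma subalg_const_mx {R : realFieldType} n (C : set 'M[R]_n) (L : 'M[R]_n) :
    mx_subalg_closed (mem C) -> C L -> L^T = L -> L *m const_mx 1 = 0 :> 'cV_n ->
    (forall x : 'cV_n, L *m x = 0 -> forall i j, x i 0 = x j 0) ->
  C (const_mx 1).
Proof.
case: n C L => [|n] C L CC CL Lsym L1 kerL.
  by rewrite [const_mx _]thinmx0; have /submod_closedP[] := mx_subalg_submod CC.
have [k [r rP charE]] := multiplicity_XsubC (char_poly L) 0.
have r0 : r.[0] != 0 by move: rP; rewrite monic_neq0 ?char_poly_monic.
set N := horner_mx L r.
have NL0 : N *m L = 0.
  apply: (@symmetric_mul_exp_eq0 _ _ _ _ k) => //.
  have := Cayley_Hamilton L; rewrite charE subr0 rmorphM rmorphXn /=.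
  by rewrite horner_mx_X.
have LN0 : L *m N = 0 by rewrite -(comm_horner_mx _ (erefl (L *m L))).
have colN i i' j : N i j = N i' j.
  have Lcol0 : L *m col j N = 0 by rewrite colE mulmxA LN0 mul0mx.
  by have := kerL _ Lcol0 i i'; rewrite !mxE.
have rowN i j j' : N i j = N i j'.
  have Lrow0 : L *m (row i N)^T = 0.
    by rewrite -Lsym -trmx_mul -row_mul NL0 row0 trmx0.
  by have := kerL _ Lrow0 j j'; rewrite !mxE.
have NE : N = N 0 0 *: const_mx 1.
  by apply/matrixP => i j; rewrite !mxE mulr1 (colN i 0) (rowN 0 j 0).
have N00 : N 0 0 != 0.
  apply: contra_neq r0 => N00; have := horner_mx_ker r L1.
  rewrite -/N NE N00 scale0r mul0mx => /colP/(_ 0).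
  by rewrite !mxE mulr1.
have -> : const_mx 1 = (N 0 0)^-1 *: N + 0.
  by rewrite addr0 {2}NE scalerA mulVf ?scale1r.
have /submod_closedP[C0 Clin] := mx_subalg_submod CC.
by apply: Clin => //; apply: subalg_horner_mx.
Qed.

(** * Endomorphisms of a subspace of a real coordinate space *)

(** A subspace that is merely a set of row vectors is the row space of any
    matrix of maximal rank among those whose rows it contains. *)
Lemma submod_row_space {F : fieldType} n (S : set 'rV[F]_n) :
  GRing.submod_closed (mem S) ->
  exists m (B : 'M[F]_(m, n)), row_free B /\ forall u, S u <-> (u <= B)%MS.
Proof.
move=> /submod_closedP[S0 Slin].
pose P k := `[< exists2 B : 'M[F]_n,
  (forall u : 'rV_n, (u <= B)%MS -> S u) & \rank B = k >].
have exP : exists k, P k.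
  exists 0%N; apply/asboolP; exists 0; last exact: mxrank0.
  by move=> u; rewrite submx0 => /eqP->.
have ubP k : P k -> (k <= n)%N.
  by move=> /asboolP[B _ <-]; apply: rank_leq_col.
case: (ex_maxnP exP ubP) => k /asboolP[B BS <-] maxB.
exists (\rank B), (row_base B); split=> [|u]; first exact: row_base_free.
rewrite eq_row_base; split=> [Su|]; last exact: BS.
have BuS (v : 'rV_n) : (v <= B + u)%MS -> S v.
  case/sub_addsmxP => -[a b] /= ->; rewrite addrC (mx11_scalar b) mul_scalar_mx.
  by apply: Slin => //; apply: BS; apply: submxMl.
have : (\rank (B + u)%MS <= \rank B)%N.
  by apply: maxB; apply/asboolP; exists (B + u)%MS.
rewrite (geq_leqif (mxrank_leqif_sup (addsmxSl B u))); apply: submx_trans.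
exact: addsmxSr.
Qed.

(** If the transposed rows of B form a basis of S, the dual basis consists of
    the columns of B^T (B B^T)^-1; these are combinations of the columns of B^T,
    so they stay in S.  The Gram matrix B B^T is invertible because the inner
    product is definite. *)
Lemma submod_dual_basis {R : realFieldType} n (S : set 'cV[R]_n) :
    GRing.submod_closed (mem S) ->
  exists m (b c : 'I_m -> 'cV[R]_n), [/\ forall i, S (b i), forall i, S (c i)
    & forall u, S u -> u = \sum_i ((c i)^T *m u) 0 0 *: b i].
Proof.
move=> /submod_closedP[S0 Slin].
have /submod_row_space[m [B [Bfree SBr]]] : GRing.submod_closed (mem [set r | S r^T]).
  apply/submod_closedP; split=> [|a u v Su Sv] /=; first by rewrite trmx0.
  by rewrite linearP; apply: Slin.
pose G := B *m B^T; pose C := B^T *m invmx G.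
have SB u : S u <-> (u^T <= B)%MS.
  by rewrite -SBr /= trmxK.
have Gunit : G \in unitmx by exact: gram_unitmx.
exists m, (fun i => (row i B)^T), (fun i => col i C); split.
- by move=> i; apply/SB; rewrite trmxK row_sub.
- move=> i; apply/SB; rewrite tr_col trmx_mul trmxK row_mul.
  exact: submxMl.
move=> u /SB/submxP[a uE]; apply: trmx_inj; rewrite linear_sum /=.
transitivity (u^T *m C *m B); first by rewrite uE /C !mulmxA -(mulmxA a) mulmxK.
rewrite mulmx_sum_row; apply: eq_bigr => i _; rewrite linearZ /= trmxK.
congr (_ *: _); rewrite -[u in RHS]trmxK -trmx_mul [RHS]mxE.
by rewrite colE [in RHS]mulmxA -colE [RHS]mxE.
Qed.

Lemma submod_endo_mx {R : realFieldType} n (S : set 'cV[R]_n)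
    (f : 'cV[R]_n -> 'cV[R]_n) :
    GRing.submod_closed (mem S) -> (forall u, S u -> S (f u)) ->
    (forall a u v, S u -> S v -> f (a *: u + v) = a *: f u + f v) ->
  exists2 X, lin_span [set u *m v^T | u in S & v in S] X
    & forall u, S u -> f u = X *m u.
Proof.
move=> Scl fS flin; have [m [b [c [Sb Sc uE]]]] := submod_dual_basis Scl.
have /submod_closedP[S0 Slin] := Scl.
have f0 : f 0 = 0.
  have := flin (-1) _ _ S0 S0; rewrite scaler0 addr0 scaleN1r addNr //.
exists (\sum_i f (b i) *m (c i)^T) => [|u Su].
  apply: submod_closed_sum => [|i]; first exact: lin_span_closed.
  by apply: mem_lin_span; exists (f (b i)); [exact: fS|exists (c i)].
have fsum (x : 'I_m -> R) : f (\sum_i x i *: b i) = \sum_i x i *: f (b i).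
  suff [] : S (\sum_i x i *: b i) /\
    f (\sum_i x i *: b i) = \sum_i x i *: f (b i) by [].
  elim/big_rec2: _ => // i v w _ [Sw <-].
  by split; [exact: Slin|exact: flin].
rewrite {1}(uE u Su) fsum mulmx_suml; apply: eq_bigr => i _.
by rewrite -mulmxA [_^T *m u]mx11_scalar mul_mx_scalar mxE eqxx mulr1n.
Qed.

(** * The Laplacian of a connected graph *)

(** Maximum principle: at a vertex where f is maximal all terms of the sum are
    nonnegative, so f takes the same maximal value at every neighbour. *)
Lemma harmonic_const {R : realFieldType} (V : finType) (e : rel V) (f : V -> R) :
    connected_graph e -> (forall x, \sum_(y | e x y) (f x - f y) = 0) ->
  forall x y, f x = f y.
Proof.
move=> e_conn harm x0 y0.
have [m _ fm] : exists2 m, true & forall x, f x <= f m.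
  case: (@Order.TotalTheory.arg_maxP _ _ _ x0 predT f isT) => m _ fm.
  by exists m => // x; apply: fm.
suff fE x : f x = f m by rewrite !fE.
have nbrE y z : f y = f m -> e y z -> f z = f m.
  move=> fy yz; have /eqP := harm y; rewrite psumr_eq0; last first.
    by move=> i _; rewrite subr_ge0 fy.
  move=> /allP/(_ z (mem_index_enum _)); rewrite yz /= subr_eq0 => /eqP <-.
  exact: fy.
have /connectP[p] := e_conn m x.
elim: p m {fm e_conn} (erefl (f m)) nbrE => [|y p IHp] z fz nbrE /=.
  by move=> _ ->.
move=> /andP[zy py] xE; have fy := nbrE _ _ fz zy.
by rewrite -fy; apply: IHp => // u v; rewrite fy; apply: nbrE.
Qed.

Section Graph.
Context {R : realType} {V : finType} (e : rel V).

Definition laplacian : 'M[R]_#|V| := degree_mx R e - adjacency_mx R e.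

Lemma laplacianE (x : 'cV_#|V|) i :
  (laplacian *m x) i 0 =
  \sum_(y | e (enum_val i) y) (x i 0 - x (enum_rank y) 0).
Proof.
rewrite mulmxBl mul_diag_mx !mxE -sum1_card natr_sum sumrB mulr_suml.
congr (_ - _); first by apply: eq_big => [y|y _]; rewrite ?inE ?mul1r.
rewrite (reindex (fun j : 'I_#|V| => enum_val j)) /=; last exact/onW_bij/enum_val_bij.
rewrite [RHS]big_mkcond; apply: eq_bigr => j _.
by rewrite mxE enum_valK; case: ifP; rewrite ?mul1r ?mul0r.
Qed.

Lemma laplacian_ones : laplacian *m const_mx 1 = 0 :> 'cV_#|V|.
Proof.
by apply/colP => i; rewrite laplacianE big1 ?mxE // => y _; rewrite !mxE subrr.
Qed.

Lemma laplacian_ker (x : 'cV_#|V|) :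
  connected_graph e -> laplacian *m x = 0 -> forall i j, x i 0 = x j 0.
Proof.
move=> e_conn Lx0 i j; rewrite -(enum_valK i) -(enum_valK j).
apply: (@harmonic_const _ _ e (fun v => x (enum_rank v) 0)) => // v.
by have := laplacianE x (enum_rank v); rewrite Lx0 mxE enum_rankK.
Qed.

Lemma adjacency_mx_tr : symmetric e -> (adjacency_mx R e)^T = adjacency_mx R e.
Proof. by move=> e_sym; apply/matrixP => i j; rewrite !mxE e_sym. Qed.

Lemma degree_mx_tr : (degree_mx R e)^T = degree_mx R e.
Proof. exact: tr_diag_mx. Qed.

(** * The graph algebra and its ideal *)

Let A := graph_alg R e.
Let M := graph_mod R e.

Lemma graph_alg_closed : mx_subalg_closed (mem A).
Proof. exact: generated_subalg_closed. Qed.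

Lemma graph_mod_closed : GRing.submod_closed (mem M).
Proof. exact: graph_mod_submod_closed. Qed.

Lemma graph_alg_mod X u : A X -> M u -> M (X *m u).
Proof.
have /mx_subalg_closedP[_ _ AM] := graph_alg_closed.
by move=> AX [Y AY <-]; exists (X *m Y); [exact: AM|rewrite mulmxA].
Qed.

Lemma graph_alg_tr X : symmetric e -> A X -> A X^T.
Proof.
move=> e_sym; apply: generated_subalg_tr => Y [[->|->]|->]; rewrite /=.
- by rewrite trmx1; left; left.
- by rewrite adjacency_mx_tr //; left; right.
- by rewrite degree_mx_tr; right.
Qed.

Lemma allones_mxE : allones_mx R V = const_mx 1.
Proof.
by apply/matrixP => i j; rewrite !mxE big_ord1 !mxE mulr1.
Qed.

Lemma graph_alg_allones :
  symmetric e -> connected_graph e -> A (allones_mx R V).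
Proof.
move=> e_sym e_conn; rewrite allones_mxE.
apply: (@subalg_const_mx _ _ A laplacian); first exact: graph_alg_closed.
- have /mx_subalg_closedP[_ Alin _] := graph_alg_closed.
  rewrite /laplacian addrC -scaleN1r.
  by apply: Alin; apply: sub_gen_smallest; [left; right|right].
- by rewrite linearB /= adjacency_mx_tr // degree_mx_tr.
- exact: laplacian_ones.
- by move=> x; apply: laplacian_ker.
Qed.

(** X J Y = (X 1) (Y^T 1)^T, and Y^T ranges over the algebra as Y does. *)
Lemma graph_ideal_gens : symmetric e ->
  [set X *m allones_mx R V *m Y | X in A & Y in A] =
  [set u *m v^T | u in M & v in M].
Proof.
move=> e_sym; apply/seteqP; split=> Z.
  move=> [X AX [Y AY <-]]; exists (X *m ones R V); first by exists X.
  exists (Y^T *m ones R V); first by exists Y^T => //; apply: graph_alg_tr.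
  by rewrite trmx_mul trmxK !mulmxA.
move=> [_ [X AX <-] [_ [Y AY <-] <-]]; exists X => //.
exists Y^T; first exact: graph_alg_tr.
by rewrite trmx_mul !mulmxA.
Qed.

Lemma graph_ideal_sub :
  symmetric e -> connected_graph e -> graph_ideal R e `<=` A.
Proof.
move=> e_sym e_conn; have Acl := graph_alg_closed.
apply: lin_span_sub => [|_ [X AX [Y AY <-]]]; first exact: mx_subalg_submod.
have /mx_subalg_closedP[_ _ AM] := Acl.
by do 2![apply: (AM _ _) => //]; apply: graph_alg_allones.
Qed.

Lemma graph_ideal_mulmx X Y : A X -> graph_ideal R e Y ->
  graph_ideal R e (X *m Y) /\ graph_ideal R e (Y *m X).
Proof.
have /mx_subalg_closedP[_ _ AM] := graph_alg_closed.
have /submod_closedP[I0 Ilin] : GRing.submod_closed (mem (graph_ideal R e)).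
  exact: lin_span_closed.
move=> AX; move: Y.
pose B := [set Y | graph_ideal R e (X *m Y) /\ graph_ideal R e (Y *m X)].
apply: (@lin_span_sub _ _ _ B) => [|_ [Z AZ [T AT <-]]].
  apply/submod_closedP; split=> [|a Y Z [XY YX] [XZ ZX]].
    by split; rewrite ?mulmx0 ?mul0mx.
  split; first by rewrite mulmxDr -scalemxAr; apply: Ilin.
  by rewrite mulmxDl -scalemxAl; apply: Ilin.
split; apply: mem_lin_span.
  by exists (X *m Z); [exact: AM|exists T; rewrite // !mulmxA].
by exists Z; [|exists (T *m X); [exact: AM|rewrite !mulmxA]].
Qed.

Lemma graph_endo_ideal (f : graph_modType R e -> graph_modType R e) :
    symmetric e -> linear f ->
  exists2 X, graph_ideal R e X & restricts_to X f.
Proof.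
move=> e_sym flin.
have g0 : graph_modType R e := 0.
(* f extended to all column vectors, by the value at 0 outside M *)
pose g (u : 'cV[R]_#|V|) := val (f (insubd g0 u)).
have insubdM u : M u -> val (insubd g0 u) = u.
  by move=> Mu; rewrite val_insubd; case: ifP => // /negP[]; apply: mem_set.
have gM u : M u -> M (g u) by move=> _; apply/set_mem; exact: (valP (f _)).
have glin a u v : M u -> M v -> g (a *: u + v) = a *: g u + g v.
  move=> Mu Mv; rewrite /g.
  have -> : insubd g0 (a *: u + v) = a *: insubd g0 u + insubd g0 v.
    apply: val_inj; rewrite linearP /= !insubdM //.
    by have /submod_closedP[_ Mlin] := graph_mod_closed; apply: Mlin.
  by rewrite flin linearP.
have [X IX gE] := submod_endo_mx graph_mod_closed gM glin.
exists X; first by rewrite /graph_ideal graph_ideal_gens.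
move=> u; rewrite -gE; last by apply/set_mem; exact: (valP u).
by rewrite /g valKd.
Qed.

End Graph.

Theorem theorem2p1 (R : realType) (V : finType) (e : rel V)
    (e_sym : symmetric e) (e_irr : irreflexive e)
    (e_conn : connected_graph e) :
  [/\ graph_ideal R e =
        lin_span [set u *m v^T | u in graph_mod R e & v in graph_mod R e],
      two_sided_ideal (graph_alg R e) (graph_ideal R e),
      (forall X, graph_ideal R e X ->
         forall u, graph_mod R e u -> graph_mod R e (X *m u)) &
      [set f : graph_modType R e -> graph_modType R e |
         exists2 X, graph_ideal R e X & restricts_to X f]
        = [set f | linear f]].
Proof.
split.
- by rewrite /graph_ideal graph_ideal_gens.
- split; [exact: graph_ideal_sub|exact: lin_span_closed|].
  by move=> X Y; apply: graph_ideal_mulmx.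
- by move=> X /(graph_ideal_sub e_sym e_conn) AX u; apply: graph_alg_mod.
- apply/seteqP; split=> f /=; last exact: graph_endo_ideal.
  move=> [X _ fE] a u v; apply: val_inj.
  by rewrite fE !linearP /= !fE.
Qed.
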